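(* Let $Y$ be a finite simple cycle set whose displacement group is nilpotent and acts regularly on $Y$. Then $Y$ is (isomorphic to) a deformation of a right linear cycle set $X$ by a suitable $\alpha\in\mathrm{Aut}(X)$ such that $\mathcal{G}(X)$ is a $p$-group for some prime number $p$.
   Context: A left quasigroup $(X,\cdot)$ is a non-empty set with a binary operation such that $\sigma_x:y\mapsto x\cdot y$ is bijective for every $x$. A cycle set is a left quasigroup with $(x\cdot y)\cdot(x\cdot z)=(y\cdot x)\cdot(y\cdot z)$ for all $x,y,z$; all cycle sets are assumed non-degenerate, i.e. $x\mapsto x\cdot x$ is bijective. $\mathcal{G}(X)=\langle\sigma_x\mid x\in X\rangle\le \mathrm{Sym}(X)$; $X$ is indecomposable if $\mathcal{G}(X)$ is transitive on $X$. The displacement group is the normal closure of $\{\sigma_x\sigma_y^{-1}\mid x,y\in X\}$ in $\mathcal{G}(X)$. A congruence is an equivalence relation $\sim$ such that $x\sim x'$ and $y\sim y'$ imply $x\cdot y\sim x'\cdot y'$ and $\sigma_x^{-1}(y)\sim\sigma_{x'}^{-1}(y')$. A cycle set is simple if it is indecomposable and its only congruences are the equality relation and the all relation. For $\alpha\in\mathrm{Aut}(X,\cdot)$, the deformation of $X$ by $\alpha$ is the set $X$ with operation $x\cdot_\alpha y:=\alpha(x\cdot y)$. A left quasigroup is right linear over a group $(G,\circ)$ if its underlying set is $G$ and there are a map $\phi:G\to G$ and $\psi\in\mathrm{Aut}(G,\circ)$ with $x\cdot y=\phi(x)\circ\psi(y)$ for all $x,y$; it is right linear if it is isomorphic to one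 that is right linear over some group. *)

(* Defs.v *)
From mathcomp Require Import all_boot all_fingroup all_solvable.

Set Implicit Arguments.
Unset Strict Implicit.
Unset Printing Implicit Defensive.

Import GroupScope.

Record finLeftQuasigroup := FinLeftQuasigroup {
  lq_sort :> finType;
  lq_op : lq_sort -> lq_sort -> lq_sort;
  lq_nonempty : 0 < #|lq_sort|;
  lq_bij : forall x, bijective (lq_op x)
}.

Declare Scope cycle_set_scope.
Local Open Scope cycle_set_scope.
Notation "x ⋅ y" := (lq_op x y) (at level 40, left associativity)
  : cycle_set_scope.

Definition lq_sigma (X : finLeftQuasigroup) (x : X) : {perm X} :=
  perm (bij_inj (lq_bij x)).

Lemma lq_sigmaE (X : finLeftQuasigroup) (x y : X) : lq_sigma x y = x ⋅ y.
Proof. exact: permE. Qed.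

(* The second conjunct is non-degeneracy. *)
Definition cycle_set (X : finLeftQuasigroup) : Prop :=
  (forall x y z : X, (x ⋅ y) ⋅ (x ⋅ z) = (y ⋅ x) ⋅ (y ⋅ z)) /\
  bijective (fun x : X => x ⋅ x).

Definition lq_permgroup (X : finLeftQuasigroup) : {group {perm X}} :=
  <<[set lq_sigma x | x : X]>>%G.

(* In {perm X} the product s * t applies s first, so the composite
   sigma_x o sigma_y^-1 is (lq_sigma y)^-1 * lq_sigma x. *)
Definition displacements (X : finLeftQuasigroup) : {set {perm X}} :=
  [set (lq_sigma y)^-1 * lq_sigma x | x : X, y : X].

(* Normal closure: generated by all lq_permgroup-conjugates. *)
Definition displacement_group (X : finLeftQuasigroup) : {group {perm X}} :=
  <<class_support (displacements X) (lq_permgroup X)>>%G.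

Definition acts_regularly (T : finType) (D : {group {perm T}}) : Prop :=
  [transitive D, on [set: T] | 'P] /\ forall x : T, 'C_D[x | 'P] = 1.

Definition indecomposable (X : finLeftQuasigroup) : Prop :=
  [transitive lq_permgroup X, on [set: X] | 'P].

Definition congruence (X : finLeftQuasigroup) (R : rel X) : Prop :=
  equivalence_rel R /\
  forall x x' y y' : X, R x x' -> R y y' ->
    R (x ⋅ y) (x' ⋅ y') /\ R ((lq_sigma x)^-1 y) ((lq_sigma x')^-1 y').

Definition simple_cycle_set (X : finLeftQuasigroup) : Prop :=
  [/\ cycle_set X, indecomposable X &
      forall R : rel X, congruence R ->
        (forall x y : X, R x y <-> x = y) \/ (forall x y : X, R x y)].

Definition isomorphic_ops (T U : Type)
    (opT : T -> T -> T) (opU : U -> U -> U) : Prop :=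
  exists2 f : T -> U, bijective f & {morph f : x y / opT x y >-> opU x y}.

Definition lq_isomorphic (X Y : finLeftQuasigroup) : Prop :=
  isomorphic_ops (@lq_op X) (@lq_op Y).

Definition lq_automorphism (X : finLeftQuasigroup) (a : {perm X}) : Prop :=
  {morph a : x y / x ⋅ y}.
Arguments lq_automorphism : clear implicits.

(* The construction makes sense for every permutation a; it is only used for
   automorphisms. *)
Definition deformation (X : finLeftQuasigroup) (a : {perm X}) :
    finLeftQuasigroup :=
  @FinLeftQuasigroup X (fun x y => a (x ⋅ y)) (lq_nonempty X)
    (fun x => bij_comp (injF_bij (@perm_inj _ a)) (lq_bij x)).
Arguments deformation : clear implicits.

Definition right_linear_over (gT : finGroupType) (op : gT -> gT -> gT) : Prop :=
  exists (phi : gT -> gT) (psi : {perm gT}),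
    psi \in Aut [set: gT] /\ forall x y : gT, op x y = phi x * psi y.

(* A group carried by a set in bijection with X is finite, so ranging over
   finGroupType loses no generality. *)
Definition right_linear (X : finLeftQuasigroup) : Prop :=
  exists (gT : finGroupType) (op : gT -> gT -> gT),
    right_linear_over op /\ isomorphic_ops (@lq_op X) op.

(* Main.v *)
(* Write l_x = sigma_x^-1. As Y is a non-degenerate cycle set, the maps
   tau_x : g |-> g o l_(g^-1 x) on G = G(Y) are commuting permutations; they
   generate an abelian group A that is regular on G (the additive group of the
   brace G(Y)), and left translation by h conjugates tau_x to tau_(h x).
   Evaluation at 1 sends A0 = <tau_x tau_y^-1> bijectively onto the displacement
   group D and, as D is nilpotent, O_p(A0) onto O_p(D). Hence
   tau_x tau_y^-1 \in O_p(A0) defines a congruence in x and y; it is not equality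
   when p divides |D|, so simplicity makes A0 a p-group. Then the p'-part z of
   tau_x does not depend on x, it is invariant under left translations, so it is
   right translation by gamma = z(1), and gamma is an automorphism of Y. Finally
   l_x o gamma^-1 is the value at 1 of the p-part of tau_x, and the values at 1
   of the p-elements of A form a p-subgroup of G: the deformation X of Y by gamma
   has a p-group as permutation group, and Y is its deformation by gamma^-1.
   X is right linear because D is regular and normalized by gamma.
   (MathComp composes permutations from left to right, which exchanges left and
   right translations.) *)
Require Import Defs.
From mathcomp Require Import all_boot all_fingroup all_solvable.

Set Implicit Arguments.
Unset Strict Implicit.
Unset Printing Implicit Defensive.

Import GroupScope.
Local Open Scope cycle_set_scope.

(** * Displacement groups and deformations of left quasigroups *)

Section LeftQuasigroup.

Variable X : finLeftQuasigroup.
Implicit Types (x y : X) (g h : {perm X}).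

Local Notation sigma := (@lq_sigma X).
Local Notation G := (lq_permgroup X).
Local Notation D := (displacement_group X).

Lemma lq_sigma_in x : sigma x \in G.
Proof. exact/mem_gen/imset_f. Qed.

Lemma displacement_group_sub : D \subset G.
Proof.
rewrite gen_subG; apply: class_support_sub_norm _ (normG _).
apply/subsetP=> _ /imset2P[x y _ _ ->].
by rewrite groupM ?groupV ?lq_sigma_in.
Qed.

Lemma displacement_group_norm : G \subset 'N(D).
Proof. exact/norms_gen/class_support_norm. Qed.

Lemma displacement_in x y : (sigma y)^-1 * sigma x \in D.
Proof.
by rewrite mem_gen // mem_class_support //; apply/imset2P; exists x y.
Qed.

Lemma displacement_group_min (H : {group {perm X}}) :
  (forall x y, (sigma y)^-1 * sigma x \in H) -> G \subset 'N(H) -> D \subset H.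
Proof.
move=> sH nHG; rewrite gen_subG class_support_sub_norm //.
by apply/subsetP=> _ /imset2P[x y _ _ ->].
Qed.

Lemma deformation_cycle_set (a : {perm X}) :
  cycle_set X -> lq_automorphism X a -> cycle_set (deformation X a).
Proof.
move=> [cycX sqX] autX; split=> [x y z | ] /=.
  by rewrite -!autX cycX.
exact: bij_comp (injF_bij (@perm_inj _ a)) sqX.
Qed.

Lemma deformation_automorphism (a b : {perm X}) :
  lq_automorphism X a -> lq_automorphism X b -> commute a b ->
  lq_automorphism (deformation X a) b.
Proof. by move=> autA autB cab x y /=; rewrite -autB -!permM cab. Qed.

Lemma lq_automorphismV (a : {perm X}) :
  lq_automorphism X a -> lq_automorphism X a^-1.
Proof. by move=> autA x y; apply: (@perm_inj _ a); rewrite autA !permKV. Qed.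

Lemma deformationK (a : {perm X}) :
  lq_isomorphic X (deformation (deformation X a) a^-1).
Proof. by exists id; [exists id | move=> x y /=; rewrite permK]. Qed.

(* Identify X with D by x = d^-1(e): inverting d turns the left-to-right product
   of permutations into composition. *)
Lemma right_linear_deformation (a : {perm X}) :
  acts_regularly D -> a \in G -> right_linear (deformation X a).
Proof.
case=> trD stD Ga.
have /card_gt0P[e _] := lq_nonempty X.
have dP x : exists d : subg_of D, (sgval d)^-1 e == x.
  have /orbitP[d Dd <-]: x \in orbit 'P D e by rewrite (atransP trD) ?inE.
  by exists (subg D d^-1); rewrite subgK ?groupV ?invgK.
pose f x := xchoose (dP x); have fE x : (sgval (f x))^-1 e = x.
  exact/eqP/(xchooseP (dP x)).
have inj_ev : injective (fun d : subg_of D => (sgval d)^-1 e).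
  move=> c d /= cd; have: (sgval c)^-1 * sgval d \in 'C_D[e | 'P].
    rewrite inE groupM ?groupV ?subgP //=.
    by apply/astab1P; rewrite /= apermE permM cd permKV.
  by rewrite stD => /set1P/eqP; rewrite -eq_mulVg1 => /eqP/val_inj.
(* Since [t] agrees with [r] at [e], the product [r * t^-1] fixes [e] and normalizes [D];
   conjugation by it is the linear part. *)
pose r := sigma e * a; pose t := (sgval (f (r e)))^-1.
have tE : t e = r e := fE _.
have Dt : t \in D by rewrite groupV subgP.
have nDr : r \in 'N(D).
  by rewrite (subsetP displacement_group_norm) // groupM ?lq_sigma_in.
have nDk : r * t^-1 \in 'N(D).
  by rewrite groupM // groupV (subsetP (normG _)).
have Dr x : r^-1 * (sigma x * a) \in D.
  rewrite invMg -mulgA (mulgA (sigma e)^-1) -conjgE.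
  rewrite memJ_norm ?displacement_in //.
  exact: subsetP displacement_group_norm _ Ga.
pose psi_fun (d : subg_of D) := subg D (sgval d ^ (r * t^-1)).
have psi_funE d : sgval (psi_fun d) = sgval d ^ (r * t^-1).
  by rewrite subgK // memJ_norm ?subgP.
have psi_inj : injective psi_fun.
  move=> c d /(congr1 sgval); rewrite !psi_funE => /conjg_inj; exact: val_inj.
pose phi (c : subg_of D) :=
  subg D (t * (r^-1 * (sigma ((sgval c)^-1 e) * a)))^-1.
exists (subg_of D), (fun c d => phi c * perm psi_inj d); split.
  exists phi, (perm psi_inj); split=> //; rewrite inE; apply/andP; split.
    by apply/subsetP=> x; rewrite inE.
  apply/morphicP=> c d _ _; apply: val_inj.
  by rewrite !permE /= !psi_funE conjMg.
exists f.
  exists (fun d : subg_of D => (sgval d)^-1 e) => [x | d].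
    exact: fE.
  by apply: inj_ev; rewrite fE.
clearbody r => x y; apply: inj_ev; rewrite fE permE morphM ?inE //=.
rewrite psi_funE /phi fE subgK; last by rewrite groupV groupM.
rewrite invMg invgK -conjVg conjgE invMg invgK /t !mulgA mulgK mulgK.
by rewrite !permM fE permK fE lq_sigmaE.
Qed.

End LeftQuasigroup.

(** * Commuting translations of the permutation group *)

Section CycleSet.

Variable Y : finLeftQuasigroup.
Hypothesis cycY : cycle_set Y.
Implicit Types (x y u v : Y) (g h : {perm Y}) (a b : {perm {perm Y}}).

Local Notation sigma := (@lq_sigma Y).
Local Notation G := (lq_permgroup Y).
Local Notation D := (displacement_group Y).

(* The identity off G, so that the group generated is faithful on G. *)
Definition translate_fun x g :=
  if g \in G then (sigma (g^-1 x))^-1 * g else g.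

Lemma translate_fun_in x g : (translate_fun x g \in G) = (g \in G).
Proof.
rewrite /translate_fun; case: ifP => // Gg.
by rewrite groupM ?groupV ?lq_sigma_in.
Qed.

(** On [G], the inverse of the image of [g] sends [x] to the square of [g^-1 x]; by non-degeneracy
    the image determines [g^-1 x], hence [g]. *)
Lemma translate_fun_inj x : injective (translate_fun x).
Proof.
move=> g h eq_gh; have := translate_fun_in x g; rewrite eq_gh translate_fun_in.
move: eq_gh; rewrite /translate_fun; case: ifP => Gg; case: ifP => //.
move=> Gh eq_gh _.
have sqE (k : {perm Y}) : ((sigma (k^-1 x))^-1 * k)^-1 x = k^-1 x ⋅ k^-1 x.
  by rewrite invMg invgK permM lq_sigmaE.
have [_ /bij_inj sq_inj] := cycY.
have eq_x : g^-1 x = h^-1 x by apply: sq_inj; rewrite /= -!sqE eq_gh.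
by move: eq_gh; rewrite eq_x => /mulgI.
Qed.

Definition translate x : {perm {perm Y}} := perm (@translate_fun_inj x).
Local Notation tau := translate.

Lemma translateE x g : g \in G -> tau x g = (sigma (g^-1 x))^-1 * g.
Proof. by move=> Gg; rewrite permE /translate_fun Gg. Qed.

Lemma translate_out x g : g \notin G -> tau x g = g.
Proof. by move=> Gg; rewrite permE /translate_fun (negPf Gg). Qed.

Lemma translate_in x g : (tau x g \in G) = (g \in G).
Proof. by rewrite permE translate_fun_in. Qed.

Lemma translate1 x : tau x 1 = (sigma x)^-1.
Proof. by rewrite translateE // invg1 perm1 mulg1. Qed.

Lemma lq_sigma_cycle x y :
  sigma x * sigma (x ⋅ y) = sigma y * sigma (y ⋅ x).
Proof.
by have [cyc _] := cycY; apply/permP=> z; rewrite !permM !lq_sigmaE cyc.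
Qed.

(** With [u = g^-1 x] and [v = g^-1 y], the two composites send [g] to
    [(sigma u * sigma (u ⋅ v))^-1 * g] and to the same with [u], [v] exchanged. *)
Lemma translateC x y : commute (tau x) (tau y).
Proof.
apply/permP=> g; rewrite !permM.
have [Gg | nGg] := boolP (g \in G); last by rewrite !translate_out.
rewrite !(translateE _ Gg) !translateE; last first.
- by rewrite groupM ?groupV ?lq_sigma_in.
- by rewrite groupM ?groupV ?lq_sigma_in.
rewrite !mulgA -!invMg; congr (_^-1 * g).
by rewrite !invMg !invgK !permM !lq_sigmaE lq_sigma_cycle.
Qed.

Definition rmul h : {perm {perm Y}} := perm (mulIg h).

Lemma rmulE h g : rmul h g = g * h. Proof. exact: permE. Qed.

Lemma rmulV h : (rmul h)^-1 = rmul h^-1.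
Proof.
by apply/permP=> g; apply: (@perm_inj _ (rmul h)); rewrite permKV !rmulE mulgKV.
Qed.

Lemma translateJ x h : h \in G -> tau x ^ rmul h = tau (h x).
Proof.
move=> Gh; apply/permP=> g.
rewrite conjgE !permM rmulV !rmulE.
have [Gg | nGg] := boolP (g \in G); last first.
  by rewrite !translate_out ?groupMr ?groupV ?mulgKV.
rewrite !translateE ?groupM ?groupV // invMg invgK permM.
by rewrite -mulgA mulgKV.
Qed.

(** * The abelian group [A] and its regular action on [G] *)

Definition translations := <<[set tau x | x : Y]>>%G.
Local Notation A := translations.

Lemma translate_mem x : tau x \in A.
Proof. exact/mem_gen/imset_f. Qed.

Lemma translations_abelian : abelian A.
Proof.
rewrite abelian_gen; apply/centsP=> _ /imsetP[x _ ->] _ /imsetP[y _ ->].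
exact: translateC.
Qed.

Lemma translationsC a b : a \in A -> b \in A -> commute a b.
Proof. by move=> Aa Ab; apply: (centsP translations_abelian). Qed.

Lemma translations_out a g : a \in A -> g \notin G -> a g = g.
Proof.
move=> Aa nGg.
have sAC : A \subset 'C(~: G | 'P).
  rewrite gen_subG; apply/subsetP=> _ /imsetP[x _ ->].
  by apply/astabP=> h; rewrite inE /= apermE => nGh; rewrite translate_out.
by apply: (astabP (subsetP sAC a Aa)); rewrite inE.
Qed.

Lemma translations_in a g : a \in A -> (a g \in G) = (g \in G).
Proof.
move=> Aa; have [Gg | nGg] := boolP (g \in G); last first.
  by rewrite translations_out // (negPf nGg).
by apply: contraTT Gg => nGag; rewrite -(permK a g) translations_out ?groupV.
Qed.

(** Under evaluation at 1 these are the left ideals of the brace on [G]. *)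
Definition rmul_stable (P : {group {perm {perm Y}}}) :=
  P \subset A /\ forall h, h \in G -> rmul h \in 'N(P).

Lemma rmul_stable_char (P Q : {group {perm {perm Y}}}) :
  Q \char P -> rmul_stable P -> rmul_stable Q.
Proof.
move=> chQP [sPA nP]; split=> [|h Gh].
  exact: subset_trans (char_sub chQP) sPA.
exact: subsetP (char_norms chQP) _ (nP h Gh).
Qed.

Lemma conj_rmul_app a g h : (a ^ rmul h) (g * h) = a g * h.
Proof. by rewrite -rmulE -rmulE conjgE -!permM !mulgA mulgV mul1g. Qed.

(** Turns products in [G] into the action of [A], so that stable subgroups of [A] give subgroups of
    [G]. *)
Lemma mul_app1 a h : a 1 * h = (a ^ rmul h) h.
Proof. by rewrite -conj_rmul_app mul1g. Qed.

Definition orbit1 (P : {group {perm {perm Y}}}) : {set {perm Y}} :=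
  [set (a : {perm {perm Y}}) 1 | a in P].

Lemma orbit1_sub P : rmul_stable P -> orbit1 P \subset G.
Proof.
move=> [sPA _]; apply/subsetP=> _ /imsetP[a Pa ->].
by rewrite translations_in ?group1 // (subsetP sPA).
Qed.

Lemma orbit1_group_set P : rmul_stable P -> group_set (orbit1 P).
Proof.
move=> stP; have [sPA nP] := stP; apply/group_setP; split.
  by apply/imsetP; exists 1; rewrite ?perm1.
move=> _ h /imsetP[a Pa ->] Oh; have Gh := subsetP (orbit1_sub stP) h Oh.
rewrite mul_app1; case/imsetP: Oh => b Pb {2}->; rewrite -permM.
by rewrite imset_f // groupM // memJ_norm ?nP.
Qed.

Lemma translations_stable : rmul_stable A.
Proof.
split=> // h Gh; rewrite (subsetP (norm_gen _)) // inE.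
apply/subsetP=> _ /imsetP[_ /imsetP[x _ ->] ->].
by rewrite translateJ // imset_f.
Qed.

Lemma translations_transitive : orbit1 A = G.
Proof.
apply/eqP; rewrite eqEsubset orbit1_sub /=; last exact: translations_stable.
rewrite -[orbit1 A]/(gval (Group (orbit1_group_set translations_stable))).
rewrite gen_subG; apply/subsetP=> _ /imsetP[x _ ->].
by rewrite -groupV -translate1 /= imset_f ?translate_mem.
Qed.

Lemma translations_free a b : a \in A -> b \in A -> a 1 = b 1 -> a = b.
Proof.
move=> Aa Ab eq1; apply/permP=> g.
have [Gg | nGg] := boolP (g \in G); last by rewrite !translations_out.
move: Gg; rewrite -translations_transitive => /imsetP[c Ac ->].
by rewrite -!permM !(translationsC Ac) // !permM eq1.
Qed.

Lemma card_orbit1 P : rmul_stable P -> #|orbit1 P| = #|P|.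
Proof.
case=> sPA _; apply: card_in_imset => a b Pa Pb.
by apply: translations_free; apply: (subsetP sPA).
Qed.

(** * The difference subgroup [A0] and the displacement group *)

Definition translations0 := <<[set (tau x * (tau y)^-1)%g | x : Y, y : Y]>>%G.
Local Notation A0 := translations0.

Lemma translations0_mem x y : tau x * (tau y)^-1 \in A0.
Proof. by rewrite mem_gen //; apply/imset2P; exists x y. Qed.

Lemma translations0_stable : rmul_stable A0.
Proof.
split=> [|h Gh].
  rewrite gen_subG; apply/subsetP=> _ /imset2P[x y _ _ ->].
  by rewrite groupM ?groupV ?translate_mem.
rewrite (subsetP (norm_gen _)) // inE.
apply/subsetP=> _ /imsetP[_ /imset2P[x y _ _ ->] ->].
by rewrite conjMg conjVg !translateJ //; apply/imset2P; exists (h x) (h y).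
Qed.

Lemma translations0_orbit : orbit1 A0 = D.
Proof.
have [sA0A nA0] := translations0_stable.
pose O := Group (orbit1_group_set translations0_stable).
apply/eqP; rewrite -[orbit1 A0]/(gval O) eqEsubset; apply/andP; split.
  (* The elements of [A] moving each [g] of [G] within its coset of [D] form a group containing the
     generators of [A0]. *)
  pose S := [set a in A | [forall g in G, a g * g^-1 \in D]].
  have gS : group_set S.
    apply/group_setP; split.
      by rewrite inE group1; apply/forall_inP=> g _; rewrite perm1 mulgV.
    move=> a b; rewrite !inE => /andP[Aa /forall_inP Da].
    move=> /andP[Ab /forall_inP Db]; rewrite groupM //.
    apply/forall_inP=> g Gg; rewrite permM -[b _](mulgKV (a g)) -mulgA.
    by rewrite groupM ?Da ?Db // translations_in.
  have sA0S : A0 \subset Group gS.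
    rewrite gen_subG; apply/subsetP=> _ /imset2P[x y _ _ ->].
    rewrite inE groupM ?groupV ?translate_mem //; apply/forall_inP=> g Gg.
    have -> : commute (tau x) (tau y)^-1 by apply/commuteV/translateC.
    rewrite permM; set k := _ g; have -> : g = tau y k by rewrite permKV.
    have Gk : k \in G by rewrite -(translate_in y) permKV.
    by rewrite !translateE // invMg invgK mulgA mulgK displacement_in.
  apply/subsetP=> _ /imsetP[a A0a ->].
  have /(subsetP sA0S) := A0a.
  by rewrite inE => /andP[_ /forall_inP/(_ 1 (group1 _))]; rewrite invg1 mulg1.
apply: displacement_group_min => [x y|].
  (* [tau (k x)] sends [k] to 1 and [tau (k y)] sends it to the displacement, so their quotient
     carries 1 to the displacement. *)
  set k := sigma x; have Gk : k \in G := lq_sigma_in x.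
  apply/imsetP; exists (tau (k y) * (tau (k x))^-1).
    exact: translations0_mem.
  have -> : 1 = tau (k x) k by rewrite translateE // permK mulVg.
  rewrite permM -[tau (k y) _]permM translateC permM permK.
  by rewrite translateE // permK.
rewrite gen_subG; apply/subsetP=> _ /imsetP[w _ ->]; rewrite inE.
apply/subsetP=> _ /imsetP[n On ->].
have Gn := subsetP (orbit1_sub translations0_stable) n On.
case/imsetP: (On) => a A0a n_a.
(* Chosen to move [(sigma w)^-1] to [(sigma w)^-1 * n]; shifting by [sigma w] turns this into the
   conjugate of [n] as a value at 1. *)
pose b := a * (tau (n w) * (tau w)^-1).
have A0b : b \in A0 by rewrite groupM ?translations0_mem.
have bw : (sigma w)^-1 * n = b (sigma w)^-1.
  rewrite -translate1 mul_app1 translateJ //.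
  rewrite {2}n_a -!permM; congr (fun_of_perm _ 1).
  rewrite [RHS](translationsC (translate_mem w)) ?(subsetP sA0A) //.
  by rewrite /b !mulgA mulgKV.
apply/imsetP; exists (b ^ rmul (sigma w)).
  by rewrite memJ_norm // nA0 ?lq_sigma_in.
by rewrite conjgE mulgA bw -conj_rmul_app mulVg.
Qed.

(** [A0] and [D] are nilpotent of equal order, so their [p]-cores are Sylow subgroups of equal
    order; the one of [D] is normal and contains every [p]-subgroup. *)
Lemma pcore_translations0_orbit p :
  nilpotent D -> orbit1 'O_p(A0) = 'O_p(D).
Proof.
move=> nilD; have stP : rmul_stable 'O_p(A0).
  exact: rmul_stable_char (pcore_char p A0) translations0_stable.
have nilA0 : nilpotent A0.
  have [sA0A _] := translations0_stable.
  exact/abelian_nil/(abelianS sA0A)/translations_abelian.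
have cardP : #|orbit1 'O_p(A0)| = #|'O_p(D)|.
  rewrite (card_orbit1 stP) (card_Hall (nilpotent_pcore_Hall p nilA0)).
  rewrite (card_Hall (nilpotent_pcore_Hall p nilD)) -translations0_orbit.
  by rewrite (card_orbit1 translations0_stable).
apply/eqP; rewrite eqEcard cardP leqnn andbT.
rewrite -[orbit1 _]/(gval (Group (orbit1_group_set stP))).
rewrite (sub_normal_Hall (nilpotent_pcore_Hall p nilD)) ?pcore_normal //.
  by rewrite /pgroup /= cardP; apply: pcore_pgroup.
by rewrite /= -translations0_orbit imsetS // pcore_sub.
Qed.

(** * The congruence given by a [p]-core *)

Section PcoreCongruence.

Variable p : nat.
Hypothesis nilD : nilpotent D.
Local Notation P := 'O_p(A0).

Let stP : rmul_stable P.
Proof. exact: rmul_stable_char (pcore_char p A0) translations0_stable. Qed.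

Lemma pcore_translate n y :
  n \in 'O_p(D) -> tau (n y) * (tau y)^-1 \in P.
Proof.
move=> On; have [/subsetP sPA nP] := stP; have Gn : n \in G.
  by rewrite (subsetP (displacement_group_sub Y)) // (subsetP (pcore_sub p D)).
have: n ^ sigma y \in 'O_p(D).
  rewrite memJ_norm //; apply: subsetP (lq_sigma_in y).
  exact: char_norm_trans (pcore_char p D) (displacement_group_norm Y).
rewrite -pcore_translations0_orbit // => /imsetP[b Pb nyE].
move: On; rewrite -pcore_translations0_orbit // => /imsetP[a Pa nE].
pose b' := b ^ rmul (sigma y)^-1.
have Pb' : b' \in P by rewrite memJ_norm ?nP ?groupV ?lq_sigma_in.
(* Both sides send 1 to [(sigma y)^-1 * n], so freeness applies. *)
have eq1 : a * tau (n y) = tau y * b'.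
  apply: translations_free.
  - by rewrite groupM ?translate_mem ?sPA.
  - exact: groupM (translate_mem y) (sPA _ Pb').
  rewrite [LHS]permM [RHS]permM -nE -translateJ // -mul_app1 translate1.
  by rewrite /b' -mul_app1 -nyE conjgE mulgA mulgK.
rewrite -(mulKg a (tau (n y))) eq1 (translationsC (translate_mem y)) ?sPA //.
by rewrite -mulgA mulgK groupM ?groupV.
Qed.

Lemma pcore_sigma x y :
  tau x * (tau y)^-1 \in P -> (sigma x)^-1 * sigma y \in 'O_p(D).
Proof.
have [/subsetP sPA nP] := stP; set a := _ * _ => Pa.
rewrite -pcore_translations0_orbit //; apply/imsetP.
exists (a ^ rmul (sigma y)); first by rewrite memJ_norm ?nP ?lq_sigma_in.
rewrite -(mulVg (sigma y)) conj_rmul_app -!translate1 -permM.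
by rewrite -translationsC ?translate_mem ?sPA // /a mulgKV.
Qed.

(** The relation is [G]-invariant. Changing the left argument within its class alters the result by
    an element of ['O_p(D)] ([pcore_sigma]), which preserves each class ([pcore_translate]). *)
Lemma pcore_congruence : congruence (fun x y => tau x * (tau y)^-1 \in P).
Proof.
set R := (R in congruence R); have [_ nP] := stP.
have R_equiv : equivalence_rel R.
  move=> x y z; split=> [|Rxy]; first by rewrite /R mulgV group1.
  by rewrite /R -[RHS](groupMl _ Rxy) mulgA mulgKV.
have R_sym x y : R x y -> R y x.
  by rewrite /R => Rxy; rewrite -groupV invMg invgK.
have R_trans x y z : R x y -> R y z -> R x z.
  by move=> Rxy; rewrite (R_equiv x y z).2.
have R_G h x y : h \in G -> R x y -> R (h x) (h y).
  move=> Gh; rewrite /R -!translateJ // -conjVg -conjMg.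
  by rewrite memJ_norm ?nP.
split=> // x x' y y' /pcore_sigma On Ry; split.
  rewrite -!lq_sigmaE -[sigma x'](mulKVg (sigma x)) permM.
  apply: R_trans (R_G _ _ _ (lq_sigma_in x) Ry) _.
  exact/R_sym/pcore_translate.
rewrite -[(sigma x')^-1](mulgK (sigma x)) permM.
have Gx : (sigma x)^-1 \in G by rewrite groupV lq_sigma_in.
apply: R_G Gx _; apply: R_trans Ry _; apply/R_sym/pcore_translate.
by rewrite -groupV invMg invgK.
Qed.

End PcoreCongruence.

Lemma simple_translations0_pgroup :
  simple_cycle_set Y -> nilpotent D -> exists2 p : nat, prime p & p.-group A0.
Proof.
move=> [_ _ simpY] nilD; have [D1 | ntD] := eqVneq (D : {set _}) 1.
  (* Here [A0] is trivial, so any prime would do. *)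
  exists 2 => //; rewrite /pgroup -(card_orbit1 translations0_stable).
  by rewrite translations0_orbit D1 cards1.
pose p := pdiv #|D|; have pr_p : prime p by rewrite pdiv_prime // cardG_gt1.
exists p => //; case: (simpY _ (pcore_congruence p nilD)) => [Req | Rall].
  have : 'O_p(D) != 1.
    rewrite -cardG_gt1 (card_Hall (nilpotent_pcore_Hall p nilD)) p_part_gt1.
    by rewrite pi_pdiv cardG_gt1.
  case/trivgPn=> n On /eqP[]; apply/permP=> y; rewrite perm1.
  exact/Req/pcore_translate.
apply: pgroupS (pcore_pgroup p A0); rewrite gen_subG.
by apply/subsetP=> _ /imset2P[x y _ _ ->]; apply: Rall.
Qed.

(** * The deformation whose permutation group is a [p]-group *)

Lemma pgroup_deformation (p : nat) : p.-group A0 ->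
  exists gamma : {perm Y}, [/\ gamma \in G, lq_automorphism Y gamma &
    p.-group (lq_permgroup (deformation Y gamma))].
Proof.
move=> pA0; have [_ nA] := translations_stable.
have /card_gt0P[e _] := lq_nonempty Y.
pose z := (tau e).`_p^'.
(* [tau x] and [tau e] differ by an element of the [p]-group [A0], whose [p']-part is trivial. *)
have zE x : (tau x).`_p^' = z.
  rewrite -(mulgKV (tau e) (tau x)) consttM; last first.
    by apply: translationsC; rewrite ?groupM ?groupV ?translate_mem.
  rewrite (constt1P _) ?mul1g // p_eltNK.
  exact/(mem_p_elt pA0)/translations0_mem.
have Az : z \in A by rewrite groupX ?translate_mem.
have zJ h : h \in G -> z ^ rmul h = z.
  by move=> Gh; rewrite -consttJ translateJ.
pose gamma := z 1; have Ggamma : gamma \in G by rewrite translations_in.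
have zE1 h : h \in G -> z h = gamma * h.
  by move=> Gh; rewrite mul_app1 zJ.
(* Evaluate at 1 the fact that [z] commutes with [tau (gamma x)]. *)
have gammaC x : gamma * (sigma (gamma x))^-1 = (sigma x)^-1 * gamma.
  rewrite -zE1 ?groupV ?lq_sigma_in // -translate1 -permM.
  rewrite translationsC ?translate_mem // permM -/gamma.
  by rewrite -translateJ // -mul_app1 translate1.
have aut_gamma : lq_automorphism Y gamma.
  move=> x y; rewrite -!lq_sigmaE -!permM; congr (fun_of_perm _ y).
  apply: (mulgI (sigma x)^-1); rewrite !mulKg mulgA -gammaC.
  by rewrite mulgKV.
exists gamma; split=> //.
pose Q := 'O_p(A)%G.
have stQ : rmul_stable Q.
  exact: rmul_stable_char (pcore_char p A) translations_stable.
have pO : p.-group (Group (orbit1_group_set stQ)).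
  by rewrite /pgroup /= card_orbit1 //; apply: pcore_pgroup.
apply: (pgroupS _ pO); rewrite gen_subG.
apply/subsetP=> _ /imsetP[x _ ->]; rewrite -groupV.
apply/imsetP; exists (tau x).`_p.
  have hallQ := nilpotent_pcore_Hall p (abelian_nil translations_abelian).
  rewrite (mem_normal_Hall hallQ) ?pcore_normal ?p_elt_constt //.
  by rewrite groupX ?translate_mem.
have -> : lq_sigma (x : deformation Y gamma) = sigma x * gamma.
  by apply/permP=> y; rewrite lq_sigmaE /= permM lq_sigmaE.
have Gtxp : (tau x).`_p 1 \in G.
  by rewrite translations_in ?groupX ?translate_mem.
(* [tau x] is its [p]-part followed by [z], which multiplies by [gamma] on the left; cancelling
   [gamma] leaves the [p]-part at 1. *)
by rewrite invMg -translate1 -{1}(consttC p (tau x)) zE permM zE1 // mulKg.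
Qed.

End CycleSet.

Theorem corollary45 (Y : finLeftQuasigroup)
    (simpleY : simple_cycle_set Y)
    (nilY : nilpotent (displacement_group Y))
    (regY : acts_regularly (displacement_group Y)) :
  exists (X : finLeftQuasigroup) (a : {perm X}),
    [/\ cycle_set X,
        right_linear X,
        lq_automorphism X a,
        lq_isomorphic Y (deformation X a) &
        exists2 p : nat, prime p & pgroup p (lq_permgroup X)].
Proof.
have [cycY _ _] := simpleY.
have [p pr_p pA0] := simple_translations0_pgroup cycY simpleY nilY.
have [g [Gg autg pX]] := pgroup_deformation pA0.
exists (deformation Y g), g^-1; split.
- exact: deformation_cycle_set.
- exact: right_linear_deformation.
- apply: deformation_automorphism => //; first exact: lq_automorphismV.
  exact/commuteV.
- exact: deformationK.
- by exists p.
Qed.
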